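(* Let $h$ be the two-dimensional Euclid's hat function. For every integer $n\ge2$, every $s>0$ and every configuration $(\zeta_1,\dots,\zeta_n)$ with $\zeta_j=(\sigma_j,x_j)\in\{-1,1\}\times\mathbb{R}^2$, $$U_n(\zeta_1,\dots,\zeta_n;h(\cdot/s)):=\sum_{1\le i<j\le n}\sigma_i\sigma_j\,h\!\left(|x_i-x_j|/s\right)\ \ge\ -\frac{1}{2}\left(n-\Big|\sum_{j=1}^n\sigma_j\Big|\right).$$
   Context: The Euclid's hat is $h:[0,\infty)\to[0,1]$, $h(w)=\frac{2}{\pi}(\arccos w-w\sqrt{1-w^2})$ for $0\le w\le1$ and $h(w)=0$ for $w>1$; equivalently $h(|x|/s)=\frac{4}{\pi s^2}(\chi_{s/2}\ast\chi_{s/2})(x)$ where $\chi_r$ is the indicator of the disc of radius $r$ centered at $0$ in $\mathbb{R}^2$. Note $h(0)=1$. *)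

(* Defs.v *)
From Stdlib Require Import Reals Lra.
Open Scope R_scope.

(* Euclid's hat h : [0,oo) -> [0,1]:
   h w = (2/PI) (acos w - w sqrt(1 - w^2)) for 0 <= w <= 1, and 0 for w > 1.
   (Arguments are always nonnegative in the statement; for w < 0 we use the
   first branch, which is irrelevant.) *)
Definition euclid_hat (w : R) : R :=
  if Rle_dec w 1 then (2 / PI) * (acos w - w * sqrt (1 - w ^ 2)) else 0.

Definition dist2 (p q : R * R) : R :=
  sqrt ((fst p - fst q) ^ 2 + (snd p - snd q) ^ 2).

Definition U_n (n : nat) (sigma : nat -> R) (x : nat -> R * R) (s : R) : R :=
  sum_f_R0 (fun j =>
    sum_f_R0 (fun i =>
      if Nat.ltb i j then sigma i * sigma j * euclid_hat (dist2 (x i) (x j) / s)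
      else 0) (pred n)) (pred n).

Definition total_charge (n : nat) (sigma : nat -> R) : R :=
  sum_f_R0 sigma (pred n).

(* Main.v *)
(** Normalise the discs to radius 1, so that pi * h(|x - y| / 2) is the area of
    the lens D(x) n D(y).  If m is the integer-valued function sum_i sigma_i 1_D(x_i),
    then m^2 >= e * m for e = 1 and e = -1; integrating over the plane gives
    n + 2 U_n >= e * sum_i sigma_i.  The integration is carried out twice, first along
    horizontal lines (where lenses are intersections of intervals) and then across
    them.  The lens between centres (0,0) and (a,b), with a = 2 cos al cos be and
    b = 2 sin al cos be, has corners at heights sin (al - be) and sin (al + be);
    between these heights its boundary has one arc on each side, and outside them
    the horizontal section is either empty or a full chord of one of the discs,
    according to whether al + be <= pi/2 or not. *)

Require Import Defs.
From Stdlib Require Import Reals Lra Lia Psatz.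
From Coquelicot Require Import Coquelicot.
Open Scope R_scope.

(** * Half-chords of the unit disc *)

Definition half_chord (v : R) : R := sqrt (1 - v ^ 2).

(* Length of the intersection with the line of height [v] of the unit discs centred
   at (0,0) and (a,b).  When [v] misses a disc, [sqrt] of a negative number is 0 and
   the section of that disc is a degenerate interval, so the formula still gives 0. *)
Definition lens_width (a b v : R) : R :=
  Rmax 0 (Rmin (half_chord v) (half_chord (v - b) + a)
          + Rmin (half_chord v) (half_chord (v - b) - a)).

Lemma half_chord_pos v : 0 <= half_chord v.
Proof. apply sqrt_pos. Qed.

Lemma half_chord_le_1 v : half_chord v <= 1.
Proof. unfold half_chord. rewrite <- sqrt_1 at 2. apply sqrt_le_1_alt. nra. Qed.

Lemma half_chord_sqr v : -1 <= v <= 1 -> half_chord v ^ 2 = 1 - v ^ 2.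
Proof. intros H. unfold half_chord. rewrite pow2_sqrt; nra. Qed.

Lemma half_chord_out v : v <= -1 \/ 1 <= v -> half_chord v = 0.
Proof. intros H. unfold half_chord. apply sqrt_neg_0. nra. Qed.

Lemma half_chord_opp v : half_chord (- v) = half_chord v.
Proof. unfold half_chord. f_equal. ring. Qed.

Lemma half_chord_sin p : - (PI / 2) <= p <= PI / 2 -> half_chord (sin p) = cos p.
Proof.
  intros [H1 H2]. unfold half_chord.
  replace (1 - sin p ^ 2) with (cos p ^ 2).
  - apply sqrt_pow2. now apply cos_ge_0.
  - generalize (sin2_cos2 p). unfold Rsqr. nra.
Qed.

(** * Integrals of half-chords *)

(** For [0 <= p <= PI / 2], the area under [half_chord] from 0 to [sin p]: a circular sector [p / 2]
    plus a triangle [sin p * cos p / 2]. *)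
Definition sector_area (p : R) : R := (p + sin p * cos p) / 2.

Lemma sector_area_PI2 : sector_area (PI / 2) = PI / 4.
Proof. unfold sector_area. rewrite cos_PI2. field. Qed.

Lemma sector_area_PI_minus p : sector_area (PI - p) = PI / 2 - sector_area p.
Proof.
  unfold sector_area. rewrite sin_minus, cos_minus, sin_PI, cos_PI. field.
Qed.

(** The term in [cos al ^ 2] is the one that cancels in the area of a lens, which depends on [be]
    alone. *)
Lemma sector_area_diff al be :
  sector_area (al + be) - sector_area (al - be)
  = be + (2 * cos al ^ 2 - 1) * (cos be * sin be).
Proof.
  unfold sector_area. rewrite sin_plus, cos_plus, sin_minus, cos_minus.
  replace 1 with (sin al * sin al + cos al * cos al) by exact (sin2_cos2 al).
  field.
Qed.

(** The substitution [v = sin y] turns the integrand into [cos y * cos y], the derivative of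
    [sector_area]; uniqueness of the integral identifies the two values. *)
Lemma is_RInt_half_chord p q :
  - (PI / 2) <= p <= PI / 2 -> - (PI / 2) <= q <= PI / 2 ->
  is_RInt half_chord (sin p) (sin q) (sector_area q - sector_area p).
Proof.
  intros Hp Hq.
  assert (Hc : forall v, continuous half_chord v).
  { intros v. unfold half_chord. apply continuous_comp.
    - apply (ex_derive_continuous (fun v => 1 - v ^ 2)). auto_derive. easy.
    - apply continuous_sqrt. }
  assert (H1 : is_RInt (fun y => scal (cos y) (half_chord (sin y))) p q
                 (RInt half_chord (sin p) (sin q))).
  { apply (is_RInt_comp half_chord sin cos).
    - intros; apply Hc.
    - intros x _; split.
      + auto_derive; [easy | ring].
      + apply continuous_cos. }
  assert (H2 : is_RInt (fun y => scal (cos y) (half_chord (sin y))) p q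
                 (sector_area q - sector_area p)).
  { apply is_RInt_ext with (fun y => cos y * cos y).
    - intros y Hy. unfold scal; simpl; unfold mult; simpl.
      rewrite half_chord_sin; [easy|].
      unfold Rmin, Rmax in Hy; destruct (Rle_dec p q); lra.
    - apply (is_RInt_derive sector_area).
      + intros y _. unfold sector_area. auto_derive; [easy|].
        generalize (sin2_cos2 y). unfold Rsqr. nra.
      + intros y _. apply (ex_derive_continuous (fun y => cos y * cos y)).
        auto_derive. easy. }
  replace (sector_area q - sector_area p) with (RInt half_chord (sin p) (sin q)).
  - apply (RInt_correct half_chord), (ex_RInt_continuous half_chord). intros; apply Hc.
  - rewrite <- (is_RInt_unique (V := R_CompleteNormedModule) _ _ _ _ H1).
    exact (is_RInt_unique (V := R_CompleteNormedModule) _ _ _ _ H2).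
Qed.

Lemma is_RInt_shift (f : R -> R) b p q l :
  is_RInt f (p - b) (q - b) l -> is_RInt (fun v => f (v - b)) p q l.
Proof.
  intros H.
  apply is_RInt_ext with (fun v => scal 1 (f (1 * v + - b))).
  - intros v _. unfold scal; simpl; unfold mult; simpl. rewrite Rmult_1_l. f_equal. ring.
  - apply (is_RInt_comp_lin f). now replace (1 * p + - b) with (p - b) by ring;
    replace (1 * q + - b) with (q - b) by ring.
Qed.

Lemma is_RInt_reflect (f : R -> R) p q l :
  is_RInt f (- q) (- p) l -> is_RInt (fun v => f (- v)) p q l.
Proof.
  intros H. rewrite <- (opp_opp l).
  apply is_RInt_ext with (fun v => opp (opp (f (- v)))).
  - intros v _. apply opp_opp.
  - apply (is_RInt_opp (V := R_NormedModule)), is_RInt_swap, (is_RInt_comp_opp f), H.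
Qed.

(** Reflection in the height [b / 2] exchanges the two discs. When [sin p + sin q = b] the bounds
    are again [sin p] and [sin q], so both discs contribute equally between the corners. *)
Lemma is_RInt_half_chord_reflected b p q :
  - (PI / 2) <= p <= PI / 2 -> - (PI / 2) <= q <= PI / 2 ->
  is_RInt (fun v => half_chord (v - b)) (b - sin q) (b - sin p)
    (sector_area q - sector_area p).
Proof.
  intros Hp Hq. apply is_RInt_shift.
  replace (b - sin q - b) with (sin (- q)) by (rewrite sin_neg; ring).
  replace (b - sin p - b) with (sin (- p)) by (rewrite sin_neg; ring).
  replace (sector_area q - sector_area p) with (sector_area (- p) - sector_area (- q)).
  - apply is_RInt_half_chord; lra.
  - unfold sector_area. rewrite !sin_neg, !cos_neg. field.
Qed.

Lemma is_RInt_eq (f g : R -> R) (p q l m : R) :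
  is_RInt g p q m -> p <= q -> (forall v, p < v < q -> f v = g v) -> m = l ->
  is_RInt f p q l.
Proof.
  intros H Hpq Hf <-. apply is_RInt_ext with g; [|easy].
  rewrite Rmin_left, Rmax_right by easy. intros v Hv. now rewrite Hf.
Qed.

Lemma is_RInt_null (f : R -> R) p q :
  p <= q -> (forall v, p < v < q -> f v = 0) -> is_RInt f p q 0.
Proof.
  intros Hpq Hf. eapply is_RInt_eq; [apply (is_RInt_const p q 0)|easy|easy|].
  unfold scal; simpl; unfold mult; simpl. ring.
Qed.

(** * Shape of the horizontal sections of a lens *)

Lemma lens_width_outer a b v :
  0 <= a -> half_chord (v - b) = 0 \/ half_chord v = 0 \/
  half_chord v + half_chord (v - b) <= a -> lens_width a b v = 0.
Proof.
  intros Ha H. unfold lens_width.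
  generalize (half_chord_pos v) (half_chord_pos (v - b)); intros H0 H1.
  apply Rmax_left. unfold Rmin.
  repeat destruct Rle_dec; destruct H as [H|[H|H]]; lra.
Qed.

Lemma lens_width_middle a b v :
  Rabs (half_chord v - half_chord (v - b)) <= a <= half_chord v + half_chord (v - b) ->
  lens_width a b v = half_chord v + half_chord (v - b) - a.
Proof.
  intros [H1 H2]. apply Rabs_le_between in H1. unfold lens_width.
  rewrite Rmin_left, Rmin_right, Rmax_right; lra.
Qed.

(** The chord of the disc at [(a,b)] is contained in that of the disc at the origin. *)
Lemma lens_width_right a b v :
  0 <= a <= half_chord v - half_chord (v - b) -> lens_width a b v = 2 * half_chord (v - b).
Proof.
  intros H. unfold lens_width. generalize (half_chord_pos (v - b)); intros Hp.
  rewrite !Rmin_right, Rmax_right; lra.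
Qed.

Lemma lens_width_left a b v :
  0 <= a <= half_chord (v - b) - half_chord v -> lens_width a b v = 2 * half_chord v.
Proof.
  intros H. unfold lens_width. generalize (half_chord_pos v); intros Hp.
  rewrite !Rmin_left, Rmax_right; lra.
Qed.

Lemma abs_sqr_le x y : 0 <= y -> x ^ 2 <= y ^ 2 -> Rabs x <= y.
Proof. intros. apply Rabs_le_between. split; nra. Qed.

(* The squared half-chords are polynomial in [v], and comparing [a] with
   [r0 + r1] or [r0 - r1] amounts to comparing [2 - v^2 - (v-b)^2 - a^2] with
   [-2 r0 r1] or [2 r0 r1].  The quartic terms cancel in the difference of squares,
   whose roots are the heights of the two corners of the lens. *)
Lemma lens_discriminant a b v :
  -1 <= v <= 1 -> -1 <= v - b <= 1 ->
  (2 * half_chord v * half_chord (v - b)) ^ 2 - (2 - v ^ 2 - (v - b) ^ 2 - a ^ 2) ^ 2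
  = a ^ 2 * (4 - (a ^ 2 + b ^ 2)) - 4 * (a ^ 2 + b ^ 2) * (v - b / 2) ^ 2.
Proof.
  intros H0 H1. rewrite !Rpow_mult_distr, !half_chord_sqr by easy. field.
Qed.

(** With half-chords r0, r1 and q = r0^2 + r1^2 - a^2, a nonnegative discriminant means |q| <= 2 r0
    r1, that is (r0 - r1)^2 <= a^2 <= (r0 + r1)^2. *)
Lemma lens_width_inside a b v :
  0 <= a -> -1 <= v <= 1 -> -1 <= v - b <= 1 ->
  4 * (a ^ 2 + b ^ 2) * (v - b / 2) ^ 2 <= a ^ 2 * (4 - (a ^ 2 + b ^ 2)) ->
  lens_width a b v = half_chord v + half_chord (v - b) - a.
Proof.
  intros Ha H0 H1 Hz. generalize (lens_discriminant a b v H0 H1); intros D.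
  generalize (half_chord_pos v) (half_chord_pos (v - b))
    (half_chord_sqr v H0) (half_chord_sqr (v - b) H1); intros P0 P1 S0 S1.
  set (q := 2 - _ - _ - _) in D.
  assert (Hq : Rabs q <= 2 * half_chord v * half_chord (v - b)).
  { apply abs_sqr_le; [|lra]. rewrite Rmult_assoc.
    apply Rmult_le_pos; [lra|]. now apply Rmult_le_pos. }
  apply Rabs_le_between in Hq. unfold q in Hq.
  apply lens_width_middle. split.
  - apply abs_sqr_le; nra.
  - nra.
Qed.

(** A nonpositive discriminant means |q| >= 2 r0 r1; the sign q <= 0 then selects a >= r0 + r1. *)
Lemma lens_width_outside_disjoint a b v :
  0 <= a ->
  (-1 <= v <= 1 -> -1 <= v - b <= 1 -> 2 - v ^ 2 - (v - b) ^ 2 - a ^ 2 <= 0) ->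
  a ^ 2 * (4 - (a ^ 2 + b ^ 2)) <= 4 * (a ^ 2 + b ^ 2) * (v - b / 2) ^ 2 ->
  lens_width a b v = 0.
Proof.
  intros Ha Hq0 Hz.
  assert (Hr : v <= -1 \/ 1 <= v \/ -1 <= v <= 1) by lra.
  assert (Hr' : v - b <= -1 \/ 1 <= v - b \/ -1 <= v - b <= 1) by lra.
  destruct Hr as [Hr | [Hr | H0]];
    [apply lens_width_outer; [easy|]; right; left; apply half_chord_out; lra ..|].
  destruct Hr' as [Hr | [Hr | H1]];
    [apply lens_width_outer; [easy|]; left; apply half_chord_out; lra ..|].
  specialize (Hq0 H0 H1). generalize (lens_discriminant a b v H0 H1); intros D.
  generalize (half_chord_pos v) (half_chord_pos (v - b))
    (half_chord_sqr v H0) (half_chord_sqr (v - b) H1); intros P0 P1 S0 S1.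
  assert (P01 := Rmult_le_pos _ _ P0 P1).
  assert (Hq : 2 * half_chord v * half_chord (v - b) <= - (2 - v ^ 2 - (v - b) ^ 2 - a ^ 2))
    by nra.
  apply lens_width_outer; [easy|]. right; right. nra.
Qed.

(** The other sign, q >= 0, gives 2 r0 r1 <= q = r0^2 + r1^2 - a^2: one chord contains the other. *)
Lemma chord_gap a b v :
  0 <= a -> -1 <= v <= 1 -> -1 <= v - b <= 1 ->
  0 <= 2 - v ^ 2 - (v - b) ^ 2 - a ^ 2 ->
  a ^ 2 * (4 - (a ^ 2 + b ^ 2)) <= 4 * (a ^ 2 + b ^ 2) * (v - b / 2) ^ 2 ->
  a ^ 2 <= (half_chord v - half_chord (v - b)) ^ 2.
Proof.
  intros Ha H0 H1 Hq0 Hz. generalize (lens_discriminant a b v H0 H1); intros D.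
  generalize (half_chord_pos v) (half_chord_pos (v - b))
    (half_chord_sqr v H0) (half_chord_sqr (v - b) H1); intros P0 P1 S0 S1.
  assert (P01 := Rmult_le_pos _ _ P0 P1).
  assert (Hq : 2 * half_chord v * half_chord (v - b) <= 2 - v ^ 2 - (v - b) ^ 2 - a ^ 2)
    by nra.
  nra.
Qed.

Lemma lens_width_outside_lower a b v :
  0 <= a -> 0 <= b -> -1 <= v <= 1 -> -1 <= v - b <= 1 -> v <= b / 2 ->
  0 <= 2 - v ^ 2 - (v - b) ^ 2 - a ^ 2 ->
  a ^ 2 * (4 - (a ^ 2 + b ^ 2)) <= 4 * (a ^ 2 + b ^ 2) * (v - b / 2) ^ 2 ->
  lens_width a b v = 2 * half_chord (v - b).
Proof.
  intros Ha Hb H0 H1 Hv Hq Hz. generalize (chord_gap a b v Ha H0 H1 Hq Hz).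
  generalize (half_chord_pos v) (half_chord_pos (v - b))
    (half_chord_sqr v H0) (half_chord_sqr (v - b) H1); intros P0 P1 S0 S1 G.
  apply lens_width_right. split; [easy|].
  (* Below mid-height, r0^2 - r1^2 = b (b - 2 v) >= 0, which fixes the sign of the gap. *)
  assert (half_chord (v - b) <= half_chord v) by nra. nra.
Qed.

Lemma lens_width_outside_upper a b v :
  0 <= a -> 0 <= b -> -1 <= v <= 1 -> -1 <= v - b <= 1 -> b / 2 <= v ->
  0 <= 2 - v ^ 2 - (v - b) ^ 2 - a ^ 2 ->
  a ^ 2 * (4 - (a ^ 2 + b ^ 2)) <= 4 * (a ^ 2 + b ^ 2) * (v - b / 2) ^ 2 ->
  lens_width a b v = 2 * half_chord v.
Proof.
  intros Ha Hb H0 H1 Hv Hq Hz. generalize (chord_gap a b v Ha H0 H1 Hq Hz).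
  generalize (half_chord_pos v) (half_chord_pos (v - b))
    (half_chord_sqr v H0) (half_chord_sqr (v - b) H1); intros P0 P1 S0 S1 G.
  apply lens_width_left. split; [easy|].
  assert (half_chord v <= half_chord (v - b)) by nra. nra.
Qed.

(** * Area of the lens in angular coordinates *)

(** Only the sines of [p] and [q] are prescribed, since [al + be] may exceed [PI / 2], where
    [is_RInt_half_chord] does not apply. The subtracted term is [a] times the height difference
    [2 * cos al * sin be] of the corners. *)
Lemma is_RInt_lens_inside al be p q :
  0 <= al <= PI / 2 -> 0 <= be <= PI / 2 ->
  - (PI / 2) <= p <= PI / 2 -> - (PI / 2) <= q <= PI / 2 ->
  sin p = sin (al - be) -> sin q = sin (al + be) ->
  is_RInt (lens_width (2 * cos al * cos be) (2 * sin al * cos be)) (sin p) (sin q)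
    (2 * (sector_area q - sector_area p) - 4 * cos al ^ 2 * cos be * sin be).
Proof.
  intros Hal Hbe Hp Hq Ep Eq.
  assert (C0 := cos_ge_0 al ltac:(lra) ltac:(lra)).
  assert (c0 := cos_ge_0 be ltac:(lra) ltac:(lra)).
  assert (S0 := sin_ge_0 al ltac:(lra) ltac:(lra)).
  assert (k0 := sin_ge_0 be ltac:(lra) ltac:(lra)).
  generalize (sin2_cos2 al) (sin2_cos2 be). unfold Rsqr. intros E1 E2.
  generalize (SIN_bound p) (SIN_bound q); intros Bp Bq.
  assert (I0 := is_RInt_half_chord p q Hp Hq).
  assert (I1 := is_RInt_half_chord_reflected (2 * sin al * cos be) p q Hp Hq).
  rewrite sin_minus in Ep. rewrite sin_plus in Eq.
  replace (2 * sin al * cos be - sin q) with (sin p) in I1 by lra.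
  replace (2 * sin al * cos be - sin p) with (sin q) in I1 by lra.
  assert (P := Rmult_le_pos _ _ C0 k0).
  eapply is_RInt_eq.
  - apply (is_RInt_minus (V := R_NormedModule)).
    + apply (is_RInt_plus (V := R_NormedModule)); [apply I0|apply I1].
    + apply (is_RInt_const _ _ (2 * cos al * cos be)).
  - lra.
  - intros v Hv. rewrite lens_width_inside; [easy | | lra | lra |].
    + apply Rmult_le_pos; lra.
    (* Multiplied by [16 * cos be ^ 2], this is the discriminant condition. *)
    + assert (Hz : (v - sin al * cos be) ^ 2 <= (cos al * sin be) ^ 2) by nra.
      replace ((2 * cos al * cos be) ^ 2 + (2 * sin al * cos be) ^ 2) with (4 * cos be ^ 2)
        by (transitivity (4 * cos be ^ 2 * (sin al * sin al + cos al * cos al));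
            [rewrite E1|]; ring).
      replace (2 * sin al * cos be / 2) with (sin al * cos be) by field.
      replace (4 - 4 * cos be ^ 2) with (4 * sin be ^ 2) by lra.
      assert (0 <= cos be ^ 2) by nra.
      assert (Hm := Rmult_le_compat_l (16 * cos be ^ 2) _ _ ltac:(lra) Hz). nra.
  - unfold minus, plus, opp, scal; simpl; unfold mult; simpl. rewrite Ep, Eq. ring.
Qed.

Lemma is_RInt_lens_angles al be A B :
  0 <= al <= PI / 2 -> 0 <= be <= PI / 2 -> A <= -1 -> 1 <= B ->
  is_RInt (lens_width (2 * cos al * cos be) (2 * sin al * cos be)) A B
    (2 * (be - cos be * sin be)).
Proof.
  intros Hal Hbe HA HB.
  assert (C0 := cos_ge_0 al ltac:(lra) ltac:(lra)).
  assert (c0 := cos_ge_0 be ltac:(lra) ltac:(lra)).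
  assert (S0 := sin_ge_0 al ltac:(lra) ltac:(lra)).
  assert (k0 := sin_ge_0 be ltac:(lra) ltac:(lra)).
  generalize (sin2_cos2 al) (sin2_cos2 be). unfold Rsqr. intros E1 E2.
  assert (Ha : 0 <= 2 * cos al * cos be) by (apply Rmult_le_pos; lra).
  assert (Hb : 0 <= 2 * sin al * cos be) by (apply Rmult_le_pos; lra).
  assert (P := Rmult_le_pos _ _ C0 k0).
  generalize (SIN_bound (al - be)) (SIN_bound (al + be)); intros Bm Bp.
  assert (Hout : forall v, cos al * sin be <= Rabs (v - sin al * cos be) ->
    (2 * cos al * cos be) ^ 2 * (4 - ((2 * cos al * cos be) ^ 2 + (2 * sin al * cos be) ^ 2))
    <= 4 * ((2 * cos al * cos be) ^ 2 + (2 * sin al * cos be) ^ 2)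
       * (v - 2 * sin al * cos be / 2) ^ 2).
  { intros v Hv.
    assert (Hz : (cos al * sin be) ^ 2 <= (v - sin al * cos be) ^ 2)
      by (rewrite <- (pow2_abs (v - _)); nra).
    replace ((2 * cos al * cos be) ^ 2 + (2 * sin al * cos be) ^ 2) with (4 * cos be ^ 2)
      by (transitivity (4 * cos be ^ 2 * (sin al * sin al + cos al * cos al));
          [rewrite E1|]; ring).
    replace (2 * sin al * cos be / 2) with (sin al * cos be) by field.
    replace (4 - 4 * cos be ^ 2) with (4 * sin be ^ 2) by lra.
    assert (0 <= cos be ^ 2) by nra.
    assert (Hm := Rmult_le_compat_l (16 * cos be ^ 2) _ _ ltac:(lra) Hz). nra. }
  destruct (Rle_dec (PI / 2) (al + be)) as [Hc | Hc].
  - assert (HS : cos be <= sin al).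
    { rewrite <- sin_shift. apply sin_incr_1; lra. }
    (* The expression is concave in [v] and equals [4 * cos be * (sin al - cos be)], which is
       nonnegative, at both ends. *)
    assert (Hq : forall v, 2 * sin al * cos be - 1 <= v <= 1 ->
      0 <= 2 - v ^ 2 - (v - 2 * sin al * cos be) ^ 2 - (2 * cos al * cos be) ^ 2).
    { intros v Hv.
      replace ((2 * cos al * cos be) ^ 2) with (4 * cos be ^ 2 - (2 * sin al * cos be) ^ 2)
        by (transitivity (4 * cos be ^ 2 * (sin al * sin al + cos al * cos al)
              - (2 * sin al * cos be) ^ 2); [rewrite E1|]; ring).
      nra. }
    assert (Hs : sin (PI - (al + be)) = sin (al + be))
      by (rewrite <- sin_PI_x; f_equal; ring).
    assert (Hp : - (PI / 2) <= PI - (al + be) <= PI / 2) by lra.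
    assert (I := is_RInt_lens_inside al be (al - be) (PI - (al + be)) Hal Hbe
      ltac:(lra) Hp eq_refl Hs).
    assert (I0 := is_RInt_half_chord (PI - (al + be)) (PI / 2) Hp ltac:(lra)).
    assert (I1 := is_RInt_half_chord_reflected (2 * sin al * cos be) (PI - (al + be)) (PI / 2)
      Hp ltac:(lra)).
    rewrite sin_PI2 in I0, I1. rewrite Hs in I, I0, I1.
    generalize (sin_minus al be) (sin_plus al be); intros Em Ep.
    replace (2 * sin al * cos be - sin (al + be)) with (sin (al - be)) in I1 by lra.
    assert (Eb : 2 * sin al * cos be = sin (al - be) + sin (al + be)) by lra.
    assert (Ez : 2 * (sin al * cos be) = sin (al - be) + sin (al + be)) by lra.
    set (b := 2 * sin al * cos be) in *. set (a := 2 * cos al * cos be) in *.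
    assert (Jl : is_RInt (lens_width a b) A (b - 1) 0).
    { apply is_RInt_null; [lra|]. intros v Hv. apply lens_width_outer; [easy|]. left.
      apply half_chord_out. lra. }
    assert (Jr : is_RInt (lens_width a b) 1 B 0).
    { apply is_RInt_null; [lra|]. intros v Hv. apply lens_width_outer; [easy|]. right; left.
      apply half_chord_out. lra. }
    (* Below the lower corner the section is a full chord of the upper disc, down to its lowest
       point [b - 1]; the upper cap is symmetric. *)
    assert (Jm : is_RInt (lens_width a b) (b - 1) (sin (al - be))
      (2 * (sector_area (PI / 2) - sector_area (PI - (al + be))))).
    { eapply is_RInt_eq; [apply (is_RInt_scal (fun v => half_chord (v - b)) _ _ 2 _ I1)
        | lra | |reflexivity].
      intros v Hv. apply lens_width_outside_lower; try lra.
      - apply Hq. lra.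
      - apply Hout. rewrite Rabs_left1; lra. }
    assert (Jp : is_RInt (lens_width a b) (sin (al + be)) 1
      (2 * (sector_area (PI / 2) - sector_area (PI - (al + be))))).
    { eapply is_RInt_eq; [apply (is_RInt_scal half_chord _ _ 2 _ I0)| lra | |reflexivity].
      intros v Hv. apply lens_width_outside_upper; try lra.
      - apply Hq. lra.
      - apply Hout. rewrite Rabs_right; lra. }
    assert (J := is_RInt_Chasles _ _ _ _ _ _ Jl (is_RInt_Chasles _ _ _ _ _ _ Jm
      (is_RInt_Chasles _ _ _ _ _ _ I (is_RInt_Chasles _ _ _ _ _ _ Jp Jr)))).
    eapply is_RInt_eq; [apply J | lra | easy |].
    (* The two caps turn [sector_area (PI - (al + be))] into [sector_area (al + be)], so the total
       agrees with the case without caps. *)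
    generalize (sector_area_diff al be); intros D.
    rewrite sector_area_PI2, sector_area_PI_minus. unfold plus; simpl. lra.
  - assert (HS : sin al < cos be).
    { rewrite <- sin_shift. apply sin_increasing_1; lra. }
    assert (I := is_RInt_lens_inside al be (al - be) (al + be) Hal Hbe
      ltac:(lra) ltac:(lra) eq_refl eq_refl).
    generalize (sin_minus al be) (sin_plus al be); intros Em Ep.
    (* With z = v - b/2 the expression is 2 - 2 z^2 - b^2/2 - a^2. It decreases in |z| and equals 2
       (sin al^2 - cos be^2) < 0 at the corners. *)
    assert (Hq : forall v, cos al * sin be <= Rabs (v - sin al * cos be) ->
      2 - v ^ 2 - (v - 2 * sin al * cos be) ^ 2 - (2 * cos al * cos be) ^ 2 <= 0).
    { clear - E1 E2 S0 c0 HS P. intros v Hv.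
      assert (Hz : (cos al * sin be) ^ 2 <= (v - sin al * cos be) ^ 2)
        by (rewrite <- (pow2_abs (v - _)); nra).
      assert (HS2 : sin al ^ 2 <= cos be ^ 2) by nra.
      assert (E3 : (cos al * sin be) ^ 2 = cos al ^ 2 * (1 - cos be ^ 2))
        by (rewrite <- E2; ring).
      assert (E4 : cos al ^ 2 = 1 - sin al ^ 2) by lra.
      rewrite E3, E4 in Hz.
      replace ((2 * cos al * cos be) ^ 2) with (4 * (1 - sin al ^ 2) * cos be ^ 2)
        by (rewrite <- E4; ring).
      nra. }
    assert (J0 : forall v, cos al * sin be <= Rabs (v - sin al * cos be) ->
      lens_width (2 * cos al * cos be) (2 * sin al * cos be) v = 0).
    { intros v Hv. apply lens_width_outside_disjoint; auto. }
    assert (Jl : is_RInt (lens_width (2 * cos al * cos be) (2 * sin al * cos be))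
      A (sin (al - be)) 0).
    { apply is_RInt_null; [lra|]. intros v Hv. apply J0. rewrite Rabs_left1; lra. }
    assert (Jr : is_RInt (lens_width (2 * cos al * cos be) (2 * sin al * cos be))
      (sin (al + be)) B 0).
    { apply is_RInt_null; [lra|]. intros v Hv. apply J0. rewrite Rabs_right; lra. }
    assert (J := is_RInt_Chasles _ _ _ _ _ _ Jl (is_RInt_Chasles _ _ _ _ _ _ I Jr)).
    eapply is_RInt_eq; [apply J | lra | easy |].
    generalize (sector_area_diff al be); intros D.
    unfold plus; simpl. lra.
Qed.

(** * Lens area for arbitrary centres *)

Lemma lens_width_far a b v :
  0 <= a -> 4 <= a ^ 2 + b ^ 2 -> lens_width a b v = 0.
Proof.
  intros Ha Hw. apply lens_width_outside_disjoint; [easy | |].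
  (* A line meeting both discs forces |b| <= 2; then v^2 + (v - b)^2 >= b^2/2 suffices. *)
  { intros H0 H1. assert (b ^ 2 <= 4) by nra. nra. }
  generalize (pow2_ge_0 a) (pow2_ge_0 (v - b / 2)); intros Ha2 Hz2.
  assert (0 <= a ^ 2 * (a ^ 2 + b ^ 2 - 4)) by (apply Rmult_le_pos; lra).
  assert (0 <= (a ^ 2 + b ^ 2) * (v - b / 2) ^ 2) by (apply Rmult_le_pos; lra). lra.
Qed.

Lemma lens_width_opp_l a b v : lens_width (- a) b v = lens_width a b v.
Proof.
  unfold lens_width. rewrite Rplus_comm. unfold Rminus. now rewrite Ropp_involutive.
Qed.

Lemma lens_width_opp_r a b v : lens_width a (- b) v = lens_width a b (- v).
Proof.
  unfold lens_width. rewrite (half_chord_opp v).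
  replace (- v - b) with (- (v - - b)) by ring. now rewrite half_chord_opp.
Qed.

Lemma acos_quadrant x : 0 <= x <= 1 -> 0 <= acos x <= PI / 2.
Proof.
  intros Hx. generalize (acos_bound x); intros Hb. split; [lra|].
  apply Rnot_lt_le. intros H. generalize (cos_lt_0 (acos x) H ltac:(lra)).
  rewrite cos_acos; lra.
Qed.

(** Polar coordinates of the second centre: [al] is its polar angle, and [be = acos (w / 2)] encodes
    its distance [w = 2 * cos be]. *)
Lemma is_RInt_lens_quadrant a b A B :
  0 <= a -> 0 <= b -> A <= -1 -> 1 <= B ->
  is_RInt (lens_width a b) A B (PI * euclid_hat (sqrt (a ^ 2 + b ^ 2) / 2)).
Proof.
  intros Ha Hb HA HB. set (w := sqrt (a ^ 2 + b ^ 2)).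
  assert (Hw : 0 <= w) by apply sqrt_pos.
  assert (Hw2 : w ^ 2 = a ^ 2 + b ^ 2) by (apply pow2_sqrt; nra).
  unfold euclid_hat. destruct Rle_dec as [H | H].
  - assert (Hbe : 0 <= acos (w / 2) <= PI / 2) by (apply acos_quadrant; lra).
    assert (Hc : cos (acos (w / 2)) = w / 2) by (apply cos_acos; lra).
    assert (Hs : sin (acos (w / 2)) = sqrt (1 - (w / 2) ^ 2)).
    { rewrite sin_acos by lra. do 2 f_equal. unfold Rsqr. ring. }
    assert (Hal : exists al, 0 <= al <= PI / 2 /\ a = w * cos al /\ b = w * sin al).
    { destruct (Req_dec w 0) as [W | W].
      (* Coincident centres have no polar angle; any value serves. *)
      - exists 0. rewrite W in *. split; [generalize PI_RGT_0; lra|]. split; nra.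
      - assert (Hq : 0 <= a / w <= 1).
        { split; [apply Rle_div_r; lra|]. apply Rle_div_l; nra. }
        exists (acos (a / w)). split; [|split].
        + now apply acos_quadrant.
        + rewrite cos_acos by lra. now field.
        + rewrite sin_acos by lra.
          replace (1 - (a / w)²) with ((b / w) ^ 2).
          * rewrite sqrt_pow2; [now field|]. apply Rle_div_r; lra.
          * unfold Rsqr. apply Rmult_eq_reg_r with (w ^ 2); [|nra].
            field_simplify; [nra | easy | easy]. }
    destruct Hal as [al [Hal [Ea Eb]]].
    assert (J := is_RInt_lens_angles al (acos (w / 2)) A B Hal Hbe HA HB).
    rewrite Hc, Hs in J.
    replace (2 * cos al * (w / 2)) with a in J by lra.
    replace (2 * sin al * (w / 2)) with b in J by lra.
    eapply is_RInt_eq; [apply J | lra | easy |].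
    field. apply PI_neq0.
  - rewrite Rmult_0_r. apply is_RInt_null; [lra|].
    intros v _. apply lens_width_far; [easy|]. nra.
Qed.

(** Reflections in the axes reduce to the first quadrant. The window stays arbitrary so that all
    pairs of discs can share one. *)
Lemma is_RInt_lens a b A B :
  A <= -1 -> 1 <= B ->
  is_RInt (lens_width a b) A B (PI * euclid_hat (sqrt (a ^ 2 + b ^ 2) / 2)).
Proof.
  assert (Hb : forall A B a b, 0 <= a -> A <= -1 -> 1 <= B ->
    is_RInt (lens_width a b) A B (PI * euclid_hat (sqrt (a ^ 2 + b ^ 2) / 2))).
  { clear. intros A B a b Ha HA HB. destruct (Rle_dec 0 b) as [H | H].
    - now apply is_RInt_lens_quadrant.
    - assert (I := is_RInt_lens_quadrant a (- b) (- B) (- A) Ha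
        ltac:(lra) ltac:(lra) ltac:(lra)).
      apply is_RInt_reflect in I.
      eapply is_RInt_eq; [apply I|lra| |].
      + intros v _. cbv beta. rewrite lens_width_opp_r. now rewrite Ropp_involutive.
      + do 4 f_equal. ring. }
  intros HA HB. destruct (Rle_dec 0 a) as [H | H]; [now apply Hb|].
  assert (I := Hb A B (- a) b ltac:(lra) HA HB).
  eapply is_RInt_eq; [apply I|lra| |].
  - intros v _. now rewrite lens_width_opp_l.
  - do 4 f_equal. ring.
Qed.

(** * The charge form and its integration *)

Lemma is_RInt_sum (f : nat -> R -> R) (l : nat -> R) A B N :
  (forall i, (i <= N)%nat -> is_RInt (f i) A B (l i)) ->
  is_RInt (fun t => sum_f_R0 (fun i => f i t) N) A B (sum_f_R0 l N).
Proof.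
  induction N as [|N IH]; intros H; simpl.
  - now apply H.
  - apply (is_RInt_plus (V := R_NormedModule)); [apply IH; intros; apply H; lia|now apply H].
Qed.

(* When [h i i = 1], this is [n + 2 U_n] minus [e] times the total charge; it is
   linear in [h] and hence commutes with integration. *)
Definition charge_form (N : nat) (sigma : nat -> R) (e : R) (h : nat -> nat -> R) : R :=
  sum_f_R0 (fun j => sum_f_R0 (fun i => sigma i * sigma j * h i j) N) N
  - e * sum_f_R0 (fun i => sigma i * h i i) N.

Lemma charge_form_integral N sigma e (h : nat -> nat -> R -> R) (H : nat -> nat -> R) A B :
  A <= B ->
  (forall i j, (i <= N)%nat -> (j <= N)%nat -> is_RInt (h i j) A B (H i j)) ->
  (forall t, A < t < B -> 0 <= charge_form N sigma e (fun i j => h i j t)) ->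
  0 <= charge_form N sigma e H.
Proof.
  intros HAB Hint Hpos.
  apply (is_RInt_le (fun _ => 0) (fun t => charge_form N sigma e (fun i j => h i j t)) A B);
    [easy | now apply is_RInt_null | | exact Hpos].
  apply (is_RInt_minus (V := R_NormedModule)).
  - apply (is_RInt_sum (fun j t => sum_f_R0 (fun i => sigma i * sigma j * h i j t) N)).
    intros j Hj. apply (is_RInt_sum (fun i t => sigma i * sigma j * h i j t)).
    intros i Hi. apply (is_RInt_scal (h i j)). now apply Hint.
  - apply (is_RInt_scal (fun t => sum_f_R0 (fun i => sigma i * h i i t) N)).
    apply (is_RInt_sum (fun i t => sigma i * h i i t)).
    intros i Hi. apply (is_RInt_scal (h i i)). now apply Hint.
Qed.

(** * Positivity at a point, on a line and in the plane *)

(** Half-open, so that the degenerate section of a missed disc is empty. *)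
Definition interval_indicator (l u t : R) : R :=
  if Rle_dec l t then if Rlt_dec t u then 1 else 0 else 0.

Lemma interval_indicator_mult l1 u1 l2 u2 t :
  interval_indicator l1 u1 t * interval_indicator l2 u2 t
  = interval_indicator (Rmax l1 l2) (Rmin u1 u2) t.
Proof.
  unfold interval_indicator, Rmax, Rmin. destruct (Rle_dec l1 l2), (Rle_dec u1 u2);
  repeat destruct Rle_dec; repeat destruct Rlt_dec; lra.
Qed.

Lemma is_RInt_interval_indicator l u A B :
  A <= l <= B -> A <= u <= B -> is_RInt (interval_indicator l u) A B (Rmax 0 (u - l)).
Proof.
  intros Hl Hu. destruct (Rle_dec l u) as [H | H].
  - rewrite Rmax_right by lra.
    assert (J : is_RInt (interval_indicator l u) l u (u - l)).
    { eapply is_RInt_eq; [apply (is_RInt_const _ _ 1)|easy| |].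
      - intros v Hv. unfold interval_indicator.
        destruct Rle_dec; [|lra]. destruct Rlt_dec; lra.
      - unfold scal; simpl; unfold mult; simpl. ring. }
    assert (J1 : is_RInt (interval_indicator l u) A l 0).
    { apply is_RInt_null; [lra|]. intros v Hv. unfold interval_indicator.
      destruct Rle_dec; lra. }
    assert (J2 : is_RInt (interval_indicator l u) u B 0).
    { apply is_RInt_null; [lra|]. intros v Hv. unfold interval_indicator.
      destruct Rle_dec; [|easy]. destruct Rlt_dec; lra. }
    eapply is_RInt_eq;
      [apply (is_RInt_Chasles _ _ _ _ _ _ J1 (is_RInt_Chasles _ _ _ _ _ _ J J2))
      |lra|easy|]. unfold plus; simpl. ring.
  - rewrite Rmax_left by lra. apply is_RInt_null; [lra|]. intros v Hv.
    unfold interval_indicator. destruct Rle_dec; [|easy]. destruct Rlt_dec; lra.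
Qed.

(** Let m be the signed count of the intervals containing [t]. Indicators are idempotent, so the
    form equals m^2 - e m, which is nonnegative because m is an integer. *)
Lemma charge_form_interval_indicator N sigma e (l u : nat -> R) t :
  (forall i, (i <= N)%nat -> sigma i = 1 \/ sigma i = -1) -> e = 1 \/ e = -1 ->
  0 <= charge_form N sigma e
    (fun i j => interval_indicator (l i) (u i) t * interval_indicator (l j) (u j) t).
Proof.
  intros Hs He. unfold charge_form.
  set (m := sum_f_R0 (fun i => sigma i * interval_indicator (l i) (u i) t) N).
  replace (sum_f_R0 (fun i => sigma i *
    (interval_indicator (l i) (u i) t * interval_indicator (l i) (u i) t)) N) with m.
  2:{ apply sum_eq. intros i _. unfold interval_indicator.
      repeat destruct Rle_dec; repeat destruct Rlt_dec; ring. }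
  replace (sum_f_R0 _ N) with (m * m).
  2:{ unfold m at 2. rewrite scal_sum. apply sum_eq. intros j _. unfold m.
      rewrite scal_sum. apply sum_eq. intros i _. ring. }
  assert (Hm : exists z, m = IZR z).
  { unfold m. clear m. induction N as [|N IH]; simpl.
    - unfold interval_indicator. destruct (Hs 0%nat ltac:(lia)) as [-> | ->];
      destruct Rle_dec; try destruct Rlt_dec;
      solve [exists 0%Z; simpl; ring | exists 1%Z; simpl; ring | exists (-1)%Z; simpl; ring].
    - destruct IH as [z ->]; [intros; apply Hs; lia|].
      unfold interval_indicator. destruct (Hs (S N) ltac:(lia)) as [-> | ->];
      destruct Rle_dec; try destruct Rlt_dec;
      solve [exists z; ring | exists (z + 1)%Z; rewrite plus_IZR; ring
            | exists (z - 1)%Z; rewrite minus_IZR; ring]. }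
  destruct Hm as [z ->]. rewrite <- mult_IZR.
  destruct He as [-> | ->].
  - assert (IZR z <= IZR (z * z)) by (apply IZR_le; nia). lra.
  - assert (IZR (- z) <= IZR (z * z)) by (apply IZR_le; nia). rewrite opp_IZR in *. lra.
Qed.

(** Translating the first centre to the origin turns the overlap of two chords into a section of the
    normalised lens. *)
Lemma lens_width_overlap x0 y0 x1 y1 v :
  Rmax 0 (Rmin (x0 + half_chord (v - y0)) (x1 + half_chord (v - y1))
          - Rmax (x0 - half_chord (v - y0)) (x1 - half_chord (v - y1)))
  = lens_width (x1 - x0) (y1 - y0) (v - y0).
Proof.
  unfold lens_width. replace (v - y0 - (y1 - y0)) with (v - y1) by ring. f_equal.
  generalize (half_chord (v - y0)) (half_chord (v - y1)); intros r0 r1.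
  unfold Rmin, Rmax. repeat destruct Rle_dec; lra.
Qed.

Lemma finite_bound (f : nat -> R) N :
  exists C, forall i, (i <= N)%nat -> Rabs (f i) <= C.
Proof.
  exists (sum_f_R0 (fun i => Rabs (f i)) N). induction N as [|N IH]; intros i Hi; simpl.
  - replace i with 0%nat by lia. lra.
  - assert (0 <= sum_f_R0 (fun i => Rabs (f i)) N)
      by (apply cond_pos_sum; intros; apply Rabs_pos).
    generalize (Rabs_pos (f (S N))); intros.
    destruct (Nat.eq_dec i (S N)) as [-> | Hne]; [lra|].
    assert (Hi' : (i <= N)%nat) by lia. specialize (IH i Hi'). lra.
Qed.

Lemma charge_form_lens_width N sigma e (X Y : nat -> R) v :
  (forall i, (i <= N)%nat -> sigma i = 1 \/ sigma i = -1) -> e = 1 \/ e = -1 ->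
  0 <= charge_form N sigma e (fun i j => lens_width (X j - X i) (Y j - Y i) (v - Y i)).
Proof.
  intros Hs He. destruct (finite_bound X N) as [C HC].
  apply (charge_form_integral N sigma e
    (fun i j t =>
       interval_indicator (X i - half_chord (v - Y i)) (X i + half_chord (v - Y i)) t
       * interval_indicator (X j - half_chord (v - Y j)) (X j + half_chord (v - Y j)) t)
    (* Half-chords are at most 1, so this window contains every section. *)
    _ (- (C + 1)) (C + 1)).
  - generalize (HC 0%nat ltac:(lia)) (Rabs_pos (X 0%nat)). lra.
  - intros i j Hi Hj. rewrite <- lens_width_overlap.
    assert (Bi := HC i Hi). assert (Bj := HC j Hj).
    apply Rabs_le_between in Bi. apply Rabs_le_between in Bj.
    generalize (half_chord_pos (v - Y i)) (half_chord_le_1 (v - Y i))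
      (half_chord_pos (v - Y j)) (half_chord_le_1 (v - Y j)); intros.
    eapply is_RInt_ext; [intros t _; symmetry; apply interval_indicator_mult|].
    apply is_RInt_interval_indicator; unfold Rmin, Rmax; repeat destruct Rle_dec; lra.
  - intros t _. now apply (charge_form_interval_indicator N sigma e
      (fun i => X i - half_chord (v - Y i)) (fun i => X i + half_chord (v - Y i))).
Qed.

Lemma charge_form_hat N sigma e (X Y : nat -> R) :
  (forall i, (i <= N)%nat -> sigma i = 1 \/ sigma i = -1) -> e = 1 \/ e = -1 ->
  0 <= charge_form N sigma e
    (fun i j => PI * euclid_hat (sqrt ((X j - X i) ^ 2 + (Y j - Y i) ^ 2) / 2)).
Proof.
  intros Hs He. destruct (finite_bound Y N) as [C HC].
  apply (charge_form_integral N sigma e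
    (fun i j v => lens_width (X j - X i) (Y j - Y i) (v - Y i)) _ (- (C + 1)) (C + 1)).
  - generalize (HC 0%nat ltac:(lia)) (Rabs_pos (Y 0%nat)). lra.
  (* Shifted by [Y i], the common window still contains [[-1, 1]]. *)
  - intros i j Hi Hj. apply is_RInt_shift, is_RInt_lens;
    generalize (HC i Hi); intros B; apply Rabs_le_between in B; lra.
  - intros v _. now apply charge_form_lens_width.
Qed.

(** * Double sums over pairs *)

Lemma sum_swap (f : nat -> nat -> R) M N :
  sum_f_R0 (fun j => sum_f_R0 (fun i => f i j) M) N
  = sum_f_R0 (fun i => sum_f_R0 (fun j => f i j) N) M.
Proof.
  induction N as [|N IH]; simpl; [easy|]. now rewrite IH, <- sum_plus.
Qed.

Lemma sum_single (c : R) j N :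
  (j <= N)%nat -> sum_f_R0 (fun i => if Nat.eqb i j then c else 0) N = c.
Proof.
  intros Hj. induction N as [|N IH].
  - now replace j with 0%nat by lia.
  - rewrite tech5. destruct (Nat.eq_dec j (S N)) as [-> | Hne].
    + rewrite Nat.eqb_refl, sum_eq_R0; [ring|].
      intros i Hi. destruct (Nat.eqb_spec i (S N)); [lia|easy].
    + rewrite IH by lia. destruct (Nat.eqb_spec (S N) j); [lia|ring].
Qed.

Lemma sum_symmetric (f : nat -> nat -> R) N :
  (forall i j, f i j = f j i) ->
  sum_f_R0 (fun j => sum_f_R0 (fun i => f i j) N) N
  = sum_f_R0 (fun i => f i i) N
    + 2 * sum_f_R0 (fun j => sum_f_R0 (fun i => if Nat.ltb i j then f i j else 0) N) N.
Proof.
  intros Hf.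
  transitivity (sum_f_R0 (fun j => f j j +
    sum_f_R0 (fun i => if Nat.ltb i j then f i j else 0) N +
    sum_f_R0 (fun i => if Nat.ltb j i then f j i else 0) N) N).
  (* Spreading the diagonal term over [i] allows a termwise comparison by trichotomy of [i] and
     [j]. *)
  - apply sum_eq. intros j Hj. rewrite <- (sum_single (f j j) j N Hj), <- !sum_plus.
    apply sum_eq. intros i _. rewrite (Hf j i).
    destruct (Nat.eqb_spec i j) as [-> | Hne].
    + rewrite Nat.ltb_irrefl. ring.
    + destruct (Nat.ltb_spec i j), (Nat.ltb_spec j i); try lia; ring.
  - rewrite !sum_plus, (sum_swap (fun i j => if Nat.ltb j i then f j i else 0)). ring.
Qed.

Lemma dist2_sym p q : dist2 p q = dist2 q p.
Proof. unfold dist2. f_equal. ring. Qed.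

Lemma euclid_hat_0 : euclid_hat 0 = 1.
Proof.
  unfold euclid_hat. destruct Rle_dec; [|lra]. rewrite acos_0, Rmult_0_l.
  field. apply PI_neq0.
Qed.

(** * Rescaling and conclusion *)

Theorem theorem2p6 :
  forall (n : nat) (s : R) (sigma : nat -> R) (x : nat -> R * R),
    (2 <= n)%nat ->
    0 < s ->
    (forall j, (j < n)%nat -> sigma j = 1 \/ sigma j = -1) ->
    U_n n sigma x s >= - (1/2) * (INR n - Rabs (total_charge n sigma)).
Proof.
  intros n s sigma x Hn Hs Hsig.
  destruct n as [|N]; [lia|].
  assert (Hsig' : forall i, (i <= N)%nat -> sigma i = 1 \/ sigma i = -1)
    by (intros; apply Hsig; lia).
  (* Scaling the centres by [2 / s] turns discs of radius [s / 2] into unit discs. *)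
  assert (Hd : forall i j,
    sqrt ((2 / s * fst (x j) - 2 / s * fst (x i)) ^ 2
          + (2 / s * snd (x j) - 2 / s * snd (x i)) ^ 2) / 2 = dist2 (x i) (x j) / s).
  { intros i j. unfold dist2.
    replace (_ + _) with
      ((2 / s) ^ 2 * ((fst (x i) - fst (x j)) ^ 2 + (snd (x i) - snd (x j)) ^ 2)) by ring.
    assert (0 < 2 / s) by (apply Rdiv_lt_0_compat; lra).
    rewrite sqrt_mult_alt by apply pow2_ge_0. rewrite sqrt_pow2 by lra. field. lra. }
  assert (Hdiag : forall i, dist2 (x i) (x i) / s = 0).
  { intros i. unfold dist2. rewrite !Rminus_diag.
    replace (0 ^ 2 + 0 ^ 2) with 0 by ring. rewrite sqrt_0. field. lra. }
  assert (H : forall e, e = 1 \/ e = -1 -> e * total_charge (S N) sigma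
    <= INR (S N) + 2 * U_n (S N) sigma x s).
  { intros e He.
    assert (P := charge_form_hat N sigma e (fun i => 2 / s * fst (x i))
      (fun i => 2 / s * snd (x i)) Hsig' He).
    assert (E : charge_form N sigma e
      (fun i j => PI * euclid_hat (sqrt ((2 / s * fst (x j) - 2 / s * fst (x i)) ^ 2
          + (2 / s * snd (x j) - 2 / s * snd (x i)) ^ 2) / 2))
      = PI * (INR (S N) + 2 * U_n (S N) sigma x s - e * total_charge (S N) sigma)).
    { transitivity (charge_form N sigma e (fun i j => PI * euclid_hat (dist2 (x i) (x j) / s))).
      { unfold charge_form. f_equal; [|f_equal]; apply sum_eq; intros j _.
        - apply sum_eq; intros i _. now rewrite Hd.
        - now rewrite Hd. }
      unfold charge_form, U_n, total_charge. simpl pred.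
      rewrite (sum_symmetric
        (fun i j => sigma i * sigma j * (PI * euclid_hat (dist2 (x i) (x j) / s)))).
      2:{ intros i j. rewrite (dist2_sym (x i) (x j)). ring. }
      (* Each diagonal term is [PI], since the charges square to 1 and the hat is 1 at 0. *)
      rewrite (sum_eq _ (fun _ => PI)), sum_cte.
      2:{ intros i Hi. rewrite Hdiag, euclid_hat_0. destruct (Hsig' i Hi) as [-> | ->]; ring. }
      rewrite (sum_eq (fun i => sigma i * (PI * euclid_hat (dist2 (x i) (x i) / s)))
        (fun i => sigma i * PI) N).
      2:{ intros i Hi. now rewrite Hdiag, euclid_hat_0, Rmult_1_r. }
      rewrite <- scal_sum.
      rewrite (sum_eq _ (fun j => sum_f_R0 (fun i => if Nat.ltb i j
        then sigma i * sigma j * euclid_hat (dist2 (x i) (x j) / s) else 0) N * PI) N).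
      2:{ intros j _. rewrite Rmult_comm, scal_sum. apply sum_eq. intros i _.
          destruct (Nat.ltb i j); ring. }
      rewrite <- scal_sum. ring. }
    cbv beta in P. rewrite E in P. generalize PI_RGT_0; intros HPI. nra. }
  (* The sign [e] is chosen as that of the total charge. *)
  unfold Rabs. destruct Rcase_abs.
  - generalize (H (-1) ltac:(now right)). lra.
  - generalize (H 1 ltac:(now left)). lra.
Qed.
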